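(* The 2-valued dynamics $T:\mathbb{C}\to\mathrm{Sym}^2(\mathbb{C})$, $T(z)=(1\pm\sqrt{z})^2$, is not strongly invertible, but it is defined by the action of a 2-valued group.
   Context: Square brackets denote multisets. $\mathrm{Sym}^2(S)=S^2/\mathfrak{S}_2$, with the quotient topology when $S$ is a topological space. $\pm\sqrt{z}$ denotes the pair of complex numbers whose square is $z$, so $T(z)=[(1+u)^2,(1-u)^2]$ where $u^2=z$. A 2-valued dynamics on $S$ is a map $T:S\to\mathrm{Sym}^2(S)$. Strong invertibility: let $G$ be the directed multigraph with vertex set $S$ in which the edge $(s_1,s_2)$ occurs as many times as $s_2$ occurs in the multiset $T(s_1)$. $T$ is strongly invertible if every vertex has exactly $2$ incoming edges (counted with multiplicity). 2-valued group: a set $X$ with a map $X\times X\to\mathrm{Sym}^2(X)$, written $x*y$, an element $e$ and a map $\mathrm{inv}:X\to X$ such that: the 4-element multisets $x*(y*z)$ and $(x*y)*z$ (elementwise products, multiset union) are equal for all $x,y,z$; $e*x=x*e=[x,x]$ for all $x$; $e\in\mathrm{inv}(x)*x$ and $e\in x*\mathrm{inv}(x)$ for all $x$. Action: a 2-valued group $A$ acts on $\mathbb{C}$ via $\nu:A\times\mathbb{C}\to\mathrm{Sym}^2(\mathbb{C})$ if (1) the 4-element multisets $\nu(a_1,\nu(a_2,s))$ and $\nu(a_1*a_2,s)$ are equal for all $a_1,a_2\in A$, $s\in\mathbb{C}$; (2) $\nu(e,s)=[s,s]$ for all $s$; (3) for each $a\in A$ the map $\nu(a,\cdot)$ is continuous.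 $T$ is defined by the action of a 2-valued group if there exist a 2-valued group $A$, an element $a\in A$ and an action $\nu$ of $A$ on $\mathbb{C}$ with $T(s)=\nu(a,s)$ for all $s\in\mathbb{C}$. *)

(* Defs.v *)
From HB Require Import structures.
From mathcomp Require Import all_boot all_order all_algebra.
From mathcomp Require Import all_classical all_reals all_analysis.
From mathcomp Require Import complex.

Set Implicit Arguments.
Unset Strict Implicit.
Unset Printing Implicit Defensive.

Import Order.TTheory GRing.Theory Num.Theory.
Import numFieldNormedType.Exports.

Local Open Scope classical_set_scope.
Local Open Scope ring_scope.
Local Open Scope card_scope.
Local Open Scope quotient_scope.

Section Sym2.
Variable S : choiceType.

Definition swap_rel : rel (S * S) :=
  fun p q => (p == q) || (p == (q.2, q.1)).

Lemma swap_rel_refl : reflexive swap_rel.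
Proof. by move=> p; rewrite /swap_rel eqxx. Qed.

Lemma swap_rel_sym : symmetric swap_rel.
Proof.
move=> [a b] [c d]; rewrite /swap_rel !xpair_eqE /=.
by rewrite (eq_sym c a) (eq_sym d b) (eq_sym c b) (eq_sym d a) [(b == c) && _]andbC.
Qed.

Lemma swap_rel_trans : transitive swap_rel.
Proof.
move=> [c d] [a b] [x y] /orP[]/eqP[-> ->] /orP[]/eqP[-> ->];
  by rewrite /swap_rel /= eqxx ?orbT.
Qed.

Canonical swap_equiv := EquivRel swap_rel swap_rel_refl swap_rel_sym swap_rel_trans.

Definition Sym2 := {eq_quot swap_equiv}.

Definition pair2 (a b : S) : Sym2 := \pi_Sym2 (a, b).

(* The elements of [a, b], listed with multiplicity, in an arbitrary order:
   only the class of this sequence modulo [perm_eq] is meaningful. *)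
Definition elems (m : Sym2) : seq S := [:: (repr m).1; (repr m).2].

Lemma pair2C a b : pair2 a b = pair2 b a.
Proof. by apply/eqmodP; rewrite /= /swap_rel /= eqxx orbT. Qed.

Lemma perm_elems a b : perm_eq (elems (pair2 a b)) [:: a; b].
Proof.
rewrite /elems /pair2; have := reprK (\pi_Sym2 (a, b)).
move/eqmodP => /=; rewrite /swap_rel; case: (repr _) => c d /=.
case/orP => /eqP [-> ->] //.
by rewrite (perm_catC [:: _] [:: _]).
Qed.

End Sym2.

Notation "[m a , b ]" := (pair2 a b) (format "[m  a ,  b ]").

Definition dynamics2 (S : choiceType) := S -> Sym2 S.

Section StrongInvertibility.
Variables (S : choiceType) (T : dynamics2 S).

(* The edges of the directed multigraph of T: the triple (s1, s2, k) is the
   k-th copy of the edge (s1, s2). *)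
Definition edges : set (S * S * nat) :=
  [set x | (x.2 < count_mem x.1.2 (elems (T x.1.1)))%N].

Definition in_edges (s : S) : set (S * S * nat) :=
  edges `&` [set x | x.1.2 = s].

Definition strongly_invertible := forall s : S, in_edges s #= `I_2.

End StrongInvertibility.

(* The 4-element multiset f(b_1) + f(b_2), for m = [b_1, b_2]. *)
Definition bind2 (S S' : choiceType) (f : S -> Sym2 S') (m : Sym2 S) : seq S' :=
  flatten [seq elems (f b) | b <- elems m].

Record group2 := Group2 {
  carrier2 :> choiceType;
  mul2 : carrier2 -> carrier2 -> Sym2 carrier2;
  unit2 : carrier2;
  inv2 : carrier2 -> carrier2;
  mul2A : forall x y z : carrier2,
    perm_eq (bind2 (fun t => mul2 x t) (mul2 y z))
            (bind2 (fun t => mul2 t z) (mul2 x y));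
  mul2_1l : forall x : carrier2, mul2 unit2 x = [m x, x];
  mul2_1r : forall x : carrier2, mul2 x unit2 = [m x, x];
  mul2_Vl : forall x : carrier2, unit2 \in elems (mul2 (inv2 x) x);
  mul2_Vr : forall x : carrier2, unit2 \in elems (mul2 x (inv2 x))
}.

Record is_action2 (A : group2) (S : topologicalType) (nu : A -> S -> Sym2 S) :
    Prop := IsAction2 {
  action2M : forall (a1 a2 : A) (s : S),
    perm_eq (bind2 (nu a1) (nu a2 s))
            (bind2 (fun a => nu a s) (mul2 a1 a2));
  action2_1 : forall s : S, nu (unit2 A) s = [m s, s];
  action2_continuous : forall a : A,
    continuous (nu a : S -> quotient_topology (Sym2 S))
}.

Definition defined_by_action (S : topologicalType) (T : dynamics2 S) :=
  exists (A : group2) (a : A) (nu : A -> S -> Sym2 S),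
    is_action2 nu /\ forall s : S, T s = nu a s.

(* The usual topology of the complex numbers, given by the modulus. *)
HB.instance Definition _ (R : realType) := NormedModule.copy R[i] R[i]^o.

Definition sqrt_dynamics (R : realType) : dynamics2 R[i] :=
  fun z => [m (1 + sqrtC z) ^+ 2, (1 - sqrtC z) ^+ 2].

Arguments sqrt_dynamics : clear implicits.

(* The choice of the square root made by [sqrtC] is irrelevant. *)
Lemma sqrt_dynamicsE (R : realType) (z u : R[i]) : u ^+ 2 = z ->
  sqrt_dynamics R z = [m (1 + u) ^+ 2, (1 - u) ^+ 2].
Proof.
move=> uz; rewrite /sqrt_dynamics.
have /eqP : sqrtC z ^+ 2 = u ^+ 2 by rewrite sqrtCK uz.
rewrite eqf_sqr => /orP[] /eqP -> //.
by rewrite opprK pair2C.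
Qed.

(* Main.v *)
Require Import Defs.
From mathcomp Require Import all_boot all_order all_algebra.
From mathcomp Require Import all_classical all_reals all_analysis.
From mathcomp Require Import complex.
From mathcomp Require Import zify ring.
Import numFieldNormedType.Exports.

(** Both the dynamics and the 2-valued group acting behind it are quotients by
    a sign.  The naturals are the integers modulo the sign, and the addition of
    the integers descends to the 2-valued law m * n = [m + n, |m - n|].  The
    complex numbers are likewise the quotient of C by the sign under
    u |-> u^2, and the translations of C by integers descend to
    n . u^2 = [(n + u)^2, (n - u)^2]; the element 1 acts as the dynamics
    [sqrt_dynamics].

    Each operation can be computed from arbitrary signed representatives
    ([absz_mul2E], [sqrt_actionE]).  Applied to representatives, both sides of
    associativity list the images of the four sums x + y + z, x + y - z,
    x - y + z, x - y - z, and so do both sides of the action axiom, with z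
    replaced by a square root u of the point.

    For continuity at z = u^2, no branch of the square root is needed: every
    point near z has some square root near u ([close_sqrt]), and the action is
    the image under the quotient map of a polynomial function of any square
    root.

    Strong invertibility fails at the branch point 0: an edge s -> 0 forces a
    square root of s to be 1 or -1, hence s = 1, and T(1) = [4, 0] contains 0
    only once.  So 0 has at most one incoming edge. *)

Set Implicit Arguments.
Unset Strict Implicit.
Unset Printing Implicit Defensive.

Import Order.TTheory GRing.Theory Num.Theory.

Local Open Scope classical_set_scope.
Local Open Scope ring_scope.
Local Open Scope card_scope.

(** * Multisets produced by 2-valued maps *)

Lemma perm_bind2_pair2 (S S' : choiceType) (f : S -> Sym2 S') (a b : S) :
  perm_eq (bind2 f [m a, b]) (elems (f a) ++ elems (f b)).
Proof.
have := perm_flatten (perm_map (fun t => elems (f t)) (perm_elems a b)).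
move=> /perm_trans; apply.
exact: perm_refl.
Qed.

Lemma perm_bind2_quad (S S' : choiceType) (f : S -> Sym2 S') (a b : S)
    (c d c' d' : S') : f a = [m c, d] -> f b = [m c', d'] ->
  perm_eq (bind2 f [m a, b]) [:: c; d; c'; d'].
Proof.
move=> fa fb; apply: perm_trans (perm_bind2_pair2 f a b) _; rewrite fa fb.
exact: perm_cat (perm_elems c d) (perm_elems c' d').
Qed.

(** * The 2-valued group of the integers modulo the sign *)

Definition absz_mul2 (m n : nat) : Sym2 nat :=
  [m absz (m%:Z + n%:Z), absz (m%:Z - n%:Z)].

(** The law is induced by the addition of the integers: changing the sign of [i]
    or [j] preserves the pair of absolute values up to a swap. *)
Lemma absz_mul2E (i j : int) :
  absz_mul2 (absz i) (absz j) = [m absz (i + j), absz (i - j)].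
Proof.
rewrite /absz_mul2.
have [->|->] : `|i|%N%:Z = i \/ `|i|%N%:Z = - i by lia.
- have [->|->] : `|j|%N%:Z = j \/ `|j|%N%:Z = - j by lia.
  + by [].
  + by rewrite opprK pair2C.
- have [->|->] : `|j|%N%:Z = j \/ `|j|%N%:Z = - j by lia.
  + by rewrite pair2C; congr ([m _, _]); lia.
  + by congr ([m _, _]); lia.
Qed.

(** Taking x, y + z and x, y - z as representatives on one side, and x + y, z and
    x - y, z on the other, both sides become the same four absolute values,
    listed in two orders. *)
Lemma absz_mul2A (x y z : nat) :
  perm_eq (bind2 (fun t => absz_mul2 x t) (absz_mul2 y z))
          (bind2 (fun t => absz_mul2 t z) (absz_mul2 x y)).
Proof.
have l := perm_bind2_quad
  (absz_mul2E x%:Z (y%:Z + z%:Z)) (absz_mul2E x%:Z (y%:Z - z%:Z)).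
have r := perm_bind2_quad (f := absz_mul2^~ _)
  (absz_mul2E (x%:Z + y%:Z) z%:Z) (absz_mul2E (x%:Z - y%:Z) z%:Z).
apply: perm_trans l _; rewrite perm_sym; apply: perm_trans r _.
rewrite !opprD !opprK !addrA.
rewrite perm_cons -(perm_rot 2); exact: perm_refl.
Qed.

Lemma absz_mul2_1l (x : nat) : absz_mul2 0 x = [m x, x].
Proof. by rewrite /absz_mul2; congr ([m _, _]); lia. Qed.

Lemma absz_mul2_1r (x : nat) : absz_mul2 x 0 = [m x, x].
Proof. by rewrite /absz_mul2; congr ([m _, _]); lia. Qed.

Lemma absz_mul2_V (x : nat) : 0%N \in elems (absz_mul2 x x).
Proof. by rewrite (perm_mem (perm_elems _ _)) subrr !inE orbT. Qed.

Definition absz_group2 : group2 :=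
  @Group2 nat absz_mul2 0%N id absz_mul2A absz_mul2_1l absz_mul2_1r
    absz_mul2_V absz_mul2_V.

(** * Its action on the complex numbers modulo the sign *)

Section SqrtAction.
Variable R : realType.
Local Notation C := R[i].

Definition sqrt_action (n : nat) (z : C) : Sym2 C :=
  [m (n%:R + sqrtC z) ^+ 2, (n%:R - sqrtC z) ^+ 2].

(** The analogue of [absz_mul2E]: the sign of the integer and the choice of the
    square root only matter up to a swap. *)
Lemma sqrt_actionE (i : int) (u : C) :
  sqrt_action (absz i) (u ^+ 2) = [m (i%:~R + u) ^+ 2, (i%:~R - u) ^+ 2].
Proof.
rewrite /sqrt_action.
have [e|e] : `|i|%N%:Z = i \/ `|i|%N%:Z = - i by lia.
all: rewrite -[_%:R]/((`|i|%N%:Z)%:~R : C) e ?rmorphN /=.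
all: have /eqP : sqrtC (u ^+ 2) ^+ 2 = u ^+ 2 by rewrite sqrtCK.
all: rewrite eqf_sqr => /orP[] /eqP ->.
- by [].
- by rewrite opprK pair2C.
- by rewrite pair2C; congr ([m _, _]); ring.
- by congr ([m _, _]); ring.
Qed.

Lemma sqrt_actionM (m n : nat) (s : C) :
  perm_eq (bind2 (sqrt_action m) (sqrt_action n s))
          (bind2 (sqrt_action^~ s) (absz_mul2 m n)).
Proof.
set u := sqrtC s; have us : s = u ^+ 2 by rewrite sqrtCK.
have l := perm_bind2_quad
  (sqrt_actionE m%:Z (n%:R + u)) (sqrt_actionE m%:Z (n%:R - u)).
have r := perm_bind2_quad (f := sqrt_action^~ _)
  (sqrt_actionE (m%:Z + n%:Z) u) (sqrt_actionE (m%:Z - n%:Z) u).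
apply: perm_trans l _; rewrite perm_sym us; apply: perm_trans r _.
rewrite !rmorphD !rmorphN /= !opprD !opprK !addrA.
rewrite perm_cons -(perm_rot 2); exact: perm_refl.
Qed.

Lemma sqrt_action0 (s : C) : sqrt_action 0 s = [m s, s].
Proof. by rewrite /sqrt_action add0r sub0r sqrrN sqrtCK. Qed.

(** The product (u - v)(u + v) = u^2 - z is small, so one of its two factors is
    small, i.e. v or -v is close to u. *)
Lemma close_sqrt (u z e : C) : 0 < e -> `|u ^+ 2 - z| < e ^+ 2 ->
  exists2 v, v ^+ 2 = z & `|u - v| < e.
Proof.
move=> e0 uz; set v := sqrtC z; have vz : v ^+ 2 = z by rewrite sqrtCK.
have [lt_uv|ge_uv] := real_ltP (normr_real (u - v)) (gtr0_real e0).
  by exists v.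
exists (- v); first by rewrite sqrrN.
rewrite opprK.
rewrite -vz subr_sqr normrM expr2 in uz.
rewrite real_ltNge ?normr_real ?gtr0_real//; apply/negP => ge_uv'.
have := ler_pM (ltW e0) (ltW e0) ge_uv ge_uv'.
by move=> /le_lt_trans /(_ uz); rewrite ltxx.
Qed.

(** The map q below, the action of n lifted along the square, is continuous since
    it is a polynomial map to pairs followed by the quotient map.  By
    [close_sqrt], the square sends each neighbourhood of u onto a neighbourhood
    of u^2, so the continuity of q descends to the action of n. *)
Lemma sqrt_action_continuous (n : nat) :
  continuous (sqrt_action n : C -> quotient_topology (Sym2 C)).
Proof.
move=> z A; set u := sqrtC z; have uz : u ^+ 2 = z by rewrite sqrtCK.
pose q (v : C) : quotient_topology (Sym2 C) :=
  \pi_(Sym2 C)%qT ((n%:R + v) ^+ 2, (n%:R - v) ^+ 2).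
have qE v : sqrt_action n (v ^+ 2) = q v by exact: (sqrt_actionE n v).
have cq : {for u, continuous q}.
  have sqr_cvg (f : C -> C) : f v @[v --> u] --> f u ->
      f v ^+ 2 @[v --> u] --> f u ^+ 2.
    by move=> fu; rewrite expr2; under eq_fun do rewrite expr2;
      apply: (cvgM fu fu).
  apply: (@continuous_comp _ _ _
    (fun v : C => ((n%:R + v) ^+ 2, (n%:R - v) ^+ 2) : C * C)); last first.
    exact: pi_continuous.
  rewrite /continuous_at.
  apply: (@cvg_pair _ _ _ (nbhs u) (nbhs ((n%:R + u) ^+ 2))
    (nbhs ((n%:R - u) ^+ 2))).
    by apply: (sqr_cvg (fun v => n%:R + v));
      exact: (cvgD (cvg_cst (n%:R : C)) (@cvg_id _ (nbhs u))).
  by apply: (sqr_cvg (fun v => n%:R - v));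
      exact: (cvgB (cvg_cst (n%:R : C)) (@cvg_id _ (nbhs u))).
rewrite -uz qE => /cq /nbhs_ballP[e /= e0 qe].
apply/nbhs_ballP; exists (e ^+ 2) => /=; first exact: exprn_gt0.
move=> w /(close_sqrt e0) [v <- uv] /=; rewrite qE; exact: qe.
Qed.

Lemma sqrt_action_is_action2 :
  is_action2 (sqrt_action : absz_group2 -> C -> Sym2 C).
Proof.
by split; [exact: sqrt_actionM|exact: sqrt_action0|exact: sqrt_action_continuous].
Qed.

(** * Incoming edges at the branch point *)

Lemma in_edges_sqrt_dynamics0 :
  in_edges (sqrt_dynamics R) 0 `<=` [set (1, 0, 0%N)].
Proof.
move=> [[s t] k] [edge_s /= t0].
have {edge_s} : (k < count_mem t (elems (sqrt_dynamics R s)))%N by exact: edge_s.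
rewrite t0 (seq.permP (perm_elems _ _)) /= addn0 !sqrf_eq0.
rewrite addr_eq0 subr_eq0.
set u := sqrtC s; have us : u ^+ 2 = s by rewrite sqrtCK.
have [u1|_] := eqVneq 1 u.
  have -> : (1 == - u) = false.
    by rewrite -u1 -addr_eq0 -(natrD _ 1 1) pnatr_eq0.
  by rewrite -us -u1 expr1n; case: k.
have [u1|_ //] := eqVneq 1 (- u).
by rewrite -us -sqrrN -u1 expr1n; case: k.
Qed.

Lemma sqrt_dynamics_not_strongly_invertible :
  ~ strongly_invertible (sqrt_dynamics R).
Proof.
move=> /(_ 0) /card_eqPle[_ le2].
have := card_le_trans le2 (subset_card_le in_edges_sqrt_dynamics0).
by rewrite (card_le_eqr card_set1) card_le_II.
Qed.

End SqrtAction.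

Theorem theorem3p1 (R : realType) :
  ~ strongly_invertible (sqrt_dynamics R) /\
  defined_by_action (sqrt_dynamics R).
Proof.
split; first exact: sqrt_dynamics_not_strongly_invertible.
exists absz_group2, 1%N, (@sqrt_action R).
by split=> //; exact: sqrt_action_is_action2.
Qed.
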